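(* Let $H$ be an exactly connected hypergraph having exactly $\ell$ distinct unified eigenvalues (i.e. its unified matrix $\mathbf{U}(H)$ has $\ell$ distinct eigenvalues). Then the exact diameter of $H$ satisfies $ED(H)\leq \ell-1$.
   Context: A hypergraph $H$ consists of a finite non-empty vertex set $V(H)$ and a multiset $E(H)$ of non-empty subsets of $V(H)$, called edges; $m(e)$ is the multiplicity of $e$ in $E(H)$. A 2-partition of a set $e$ is an unordered pair $\{S,S'\}$ of non-empty disjoint sets with $S\cup S'=e$; $S$ and $S'$ are called parts of $e$. $I(H)$ is the set of all parts of all edges of $H$ together with all singleton subsets of $V(H)$, and $k=|I(H)|$ is the $e$-index of $H$. The unified matrix $\mathbf{U}(H)$ is the $k\times k$ matrix indexed by $I(H)$ whose $(S,S')$ entry is: $m(S)$ if $S=S'$ is a singleton which is an edge of $H$; $m(e)$ if $\{S,S'\}$ is a 2-partition of an edge $e$ of $H$; and $0$ otherwise. Its eigenvalues are the unified eigenvalues of $H$. An exact path in $H$ joining $S_0$ and $S_n$ is a sequence $S_0,e_1,S_1,e_2,\dots,e_n,S_n$ ($n\ge 1$) such that $\{S_{i-1},S_i\}$ is a 2-partition of the edge $e_i$ of $H$ for each $i=1,\dots,n$, and $S_0,\dots,S_n$ are all distinct; its length is $n$. $H$ is exactly connected if for any two distinct vertices $u,v$ there exist $S,S'\in I(H)$ with $u\in S$, $v\in S'$ such that $S$ and $S'$ are joined by an exact path in $H$. The exact distance $ed_H(u,v)$ between distinct vertices $u,v$ is the length of a shortest exact path joining some $S,S'\in I(H)$ with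 $u\in S$ and $v\in S'$ (and $\infty$ if there is none), and $ed_H(u,u)=0$. For an exactly connected $H$, the exact diameter is $ED(H)=\max\{ed_H(u,v) : u,v\in V(H)\}$. *)

(* Defs.v *)
From mathcomp Require Import all_boot all_order all_algebra.
From mathcomp Require Import finmap multiset.

Set Implicit Arguments.
Unset Strict Implicit.
Unset Printing Implicit Defensive.

Import GRing.Theory.

Local Open Scope nat_scope.

(* The vertex set V(H) is the whole finite type [vertex H]; the multiplicity
   m(e) of an edge e is [edges H e]. *)
Record hypergraph := Hypergraph {
  vertex : finType;
  edges : ({mset {set vertex}})%mset;
  vertex_nonempty : 0 < #|vertex|;
  edge_nonempty : forall e : {set vertex}, e \in edges -> e != set0
}.

Section Hypergraph.
Variable H : hypergraph.
Notation V := (vertex H).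

Definition two_partition (S S' e : {set V}) : bool :=
  [&& S != set0, S' != set0, [disjoint S & S'] & S :|: S' == e].

Definition is_part (S e : {set V}) : bool :=
  [exists S' : {set V}, two_partition S S' e].

Definition index_set : {set {set V}} :=
  [set S | [exists e : {set V}, (e \in edges H) && is_part S e]]
    :|: [set [set v] | v : V].

Definition e_index : nat := #|index_set|.

(* In the second case the edge e is unique, since it must be S :|: S'. *)
Definition unified_entry (S S' : {set V}) : nat :=
  if [&& S == S', #|S| == 1 & S \in edges H] then edges H S
  else if [pick e | (e \in edges H) && two_partition S S' e] is Some e
       then edges H e
  else 0.

(* Rows and columns are numbered by the enumeration of the index set. *)
Definition unified_matrix (C : numClosedFieldType) : 'M[C]_e_index :=
  \matrix_(i < e_index, j < e_index)
    ((unified_entry (enum_val i) (enum_val j))%:R)%R.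

(* The sequence S0, e1, S1, ..., en, Sn is encoded by S0 and the list
   p = [:: (e1, S1); ...; (en, Sn)], so that its length n is [size p]. *)
Fixpoint exact_walk (S0 : {set V}) (p : seq ({set V} * {set V})) : bool :=
  if p is (e, S1) :: p' then
    [&& e \in edges H, two_partition S0 S1 e & exact_walk S1 p']
  else true.

Definition exact_path (S0 : {set V}) (p : seq ({set V} * {set V})) : bool :=
  [&& 0 < size p, exact_walk S0 p & uniq (S0 :: unzip2 p)].

Definition joined_by_length (n : nat) (S S' : {set V}) : bool :=
  [exists p : n.-tuple ({set V} * {set V}),
     exact_path S p && (last S (unzip2 p) == S')].

Definition linked (u v : V) (n : nat) : bool :=
  [exists S in index_set, exists S' in index_set,
     [&& u \in S, v \in S' & joined_by_length n S S']].

Definition exactly_connected : Prop :=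
  forall u v : V, u != v ->
  exists S S' : {set V},
    [/\ S \in index_set, S' \in index_set, u \in S, v \in S' &
        exists n : nat, joined_by_length n S S'].

Lemma linked_bound u v n : linked u v n -> n < #|{set V}|.
Proof.
case/exists_inP=> S _ /exists_inP[S' _ /and3P[_ _ /existsP[p]]].
case/andP=> /and3P[_ _ /card_uniqP card_p] _.
by rewrite (leq_trans _ (max_card (mem (S :: unzip2 p)))) // card_p /= size_map
           size_tuple.
Qed.

Lemma linkedP u v :
  reflect (exists n, linked u v n) [exists n : 'I_#|{set V}|, linked u v n].
Proof.
apply: (iffP existsP) => [[n uvn]|[n uvn]]; first by exists n.
by exists (Ordinal (linked_bound uvn)).
Qed.

(* [None] stands for an infinite distance; [ex_minn] is the least length. *)
Definition exact_dist (u v : V) : option nat :=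
  if u == v then Some 0
  else if linkedP u v is ReflectT ex_uv then Some (ex_minn ex_uv)
  else None.

Lemma exact_dist_finite u v : exactly_connected -> exact_dist u v != None.
Proof.
move=> cH; rewrite /exact_dist; have [//|neq_uv] := eqVneq u v.
case: linkedP => // -[]; have [S [S' [IS IS' uS vS' [n Sn]]]] := cH u v neq_uv.
by exists n; apply/exists_inP; exists S => //; apply/exists_inP; exists S' => //;
   apply/and3P.
Qed.

(* Only meaningful when H is exactly connected: then, by [exact_dist_finite],
   the default value 0 is never used. *)
Definition exact_diameter : nat :=
  \max_(u : V) \max_(v : V) odflt 0 (exact_dist u v).

End Hypergraph.

Definition has_distinct_eigenvalues (F : fieldType) (n : nat) (A : 'M[F]_n)
    (ell : nat) : Prop :=
  exists s : seq F,
    [/\ uniq s, size s = ell & forall a : F, (a \in s) = eigenvalue A a].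

(* Main.v *)
Require Import Defs.
From mathcomp Require Import all_boot all_order all_algebra.
From mathcomp Require Import finmap multiset.

(** Read [U := unified_matrix H C] as the weighted adjacency matrix of the
    graph on I(H) in which [S] and [S'] are adjacent when they form a
    2-partition of an edge, with a loop at each singleton edge.  It has
    nonnegative entries, so the [(S, S')] entry of [U ^+ k] is nonzero as soon
    as there is an exact path of length [k] from [S] to [S']
    ([exact_walk_power]).  Conversely, a nonzero entry off the diagonal
    gives an exact path of length at most [k] ([power_joined]): erase the loops
    of the walk, which also discards the steps that come from diagonal entries
    of [U].  Hence, if [d] is the exact distance of [u] and [v], attained
    by a path from [S] to [S'], then [d] is the first exponent for which the
    [(S, S')] entry of the power of [U] is nonzero.

    On the other hand [U] is real symmetric, hence diagonalizable, and is
    annihilated by the product of the [X - a] over its [ell] distinct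
    eigenvalues [a].  Multiplying by a power of [X], if [ell <= d], gives a monic
    annihilating polynomial of degree [d], which writes [U ^+ d] as a
    combination of smaller powers; but all of those vanish at [(S, S')].  So
    [d < ell] ([first_nonzero_power_lt]). *)

Set Implicit Arguments.
Unset Strict Implicit.
Unset Printing Implicit Defensive.

Import GRing.Theory Num.Theory.

Local Open Scope ring_scope.

(** * Powers of a normal matrix *)

Lemma spectral_power_entry (C : numClosedFieldType) (n : nat) (A : 'M[C]_n)
    (k : nat) (i j : 'I_n) :
  A \is normalmx ->
  (A ^+ k) i j = \sum_l invmx (spectralmx A) i l * spectral_diag A 0 l ^+ k
                          * spectralmx A l j.
Proof.
move/orthomx_spectralP; set P := spectralmx A; set D := spectral_diag A => defA.
have uP : P \in unitmx by apply: spectral_unit.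
have defAk : A ^+ k = invmx P *m diag_mx (\row_l D 0 l ^+ k) *m P.
  elim: k => [|k IHk].
    have -> : \row_l D 0 l ^+ 0 = const_mx 1 :> 'rV_n.
      by apply/rowP=> l; rewrite !mxE.
    by rewrite expr0 diag_const_mx mulmx1 mulVmx.
  have -> : diag_mx (\row_l D 0 l ^+ k.+1) =
            diag_mx (\row_l D 0 l ^+ k) *m diag_mx D.
    rewrite mulmx_diag; congr diag_mx; apply/rowP=> l.
    by rewrite !mxE exprSr.
  (* The ring product of square matrices unfolds to the matrix product. *)
  rewrite exprSr IHk {1}defA; change (GRing.mul ?a ?b) with (a *m b).
  by rewrite !mulmxA mulmxK.
rewrite defAk mxE; apply: eq_bigr => l _; congr (_ * _).
by rewrite mul_mx_diag !mxE.
Qed.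

Lemma spectral_diag_eigenvalue (C : numClosedFieldType) (n : nat)
    (A : 'M[C]_n) (l : 'I_n) :
  A \is normalmx -> eigenvalue A (spectral_diag A 0 l).
Proof.
move/orthomx_spectralP => defA.
have uP : spectralmx A \in unitmx by apply: spectral_unit.
apply/eigenvalueP; exists (row l (spectralmx A)).
  by rewrite {2}defA !mulmxA -row_mul mulmxV // row1 -rowE row_diag_mx
             -scalemxAl -rowE.
apply/eqP => /(congr1 (mulmx^~ (invmx (spectralmx A)))).
rewrite -row_mul mulmxV // mul0mx row1 => /rowP/(_ l)/eqP.
by rewrite !mxE !eqxx oner_eq0.
Qed.

(** If [s] had at most [d] elements, the monic polynomial
    [X^(d - size s) * \prod_(a <- s) (X - a)] of degree [d] would annihilate
    [A] and express the entry of [A ^+ d] by the vanishing earlier ones. *)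
Lemma first_nonzero_power_lt (C : numClosedFieldType) (n : nat) (A : 'M[C]_n)
    (s : seq C) (d : nat) (i j : 'I_n) :
  A \is normalmx -> (forall a, eigenvalue A a -> a \in s) ->
  (forall k, (k < d)%N -> (A ^+ k) i j = 0) -> (A ^+ d) i j != 0 ->
  (d < size s)%N.
Proof.
move=> nA eigs low_0; apply: contraNltn => le_s_d.
pose q := 'X^(d - size s) * \prod_(a <- s) ('X - a%:P).
have q_monic : q \is monic by rewrite monicMl ?monicXn ?monic_prod_XsubC.
have size_q : size q = d.+1.
  rewrite size_monicM ?monicXn ?monic_neq0 ?monic_prod_XsubC //.
  by rewrite size_polyXn size_prod_XsubC addSn addnS subnK.
have q_root l : q.[spectral_diag A 0 l] = 0.
  apply/eqP; rewrite hornerM mulf_eq0 -[X in _ || X]/(root _ _).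
  by rewrite root_prod_XsubC eigs ?orbT // spectral_diag_eigenvalue.
have qA0 : \sum_(k < d.+1) q`_k * (A ^+ k) i j = 0.
  transitivity (\sum_l invmx (spectralmx A) i l * q.[spectral_diag A 0 l]
                         * spectralmx A l j).
    under [RHS]eq_bigr => l _ do
      rewrite horner_coef size_q mulr_sumr mulr_suml.
    rewrite exchange_big /=; apply: eq_bigr => k _.
    rewrite spectral_power_entry // mulr_sumr; apply: eq_bigr => l _.
    by rewrite !mulrA [q`_k * _]mulrC.
  by rewrite big1 // => l _; rewrite q_root mulr0 mul0r.
move: qA0; rewrite big_ord_recr big1 /= => [|k _]; last first.
  by rewrite low_0 ?mulr0.
have -> : q`_d = 1 by rewrite -(monicP q_monic) lead_coefE size_q.
by rewrite add0r mul1r => ->.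
Qed.

(** * The graph of the unified matrix *)

Section UnifiedGraph.

Variable H : hypergraph.
Notation V := (vertex H).
Implicit Types (S T e : {set V}) (p : seq ({set V} * {set V})).

Definition exact_adj S T : bool :=
  [exists e, (e \in edges H) && two_partition S T e].

Lemma two_partitionC S T e : two_partition S T e = two_partition T S e.
Proof. by rewrite /two_partition disjoint_sym setUC; do !bool_congr. Qed.

Lemma two_partition_neq S T e : two_partition S T e -> S != T.
Proof.
by case/and4P=> nzS _ dST _; apply: contraNneq nzS => eST;
   rewrite -setI_eq0 -eST setIid in dST.
Qed.

Lemma exact_adj_part S T : exact_adj S T -> T \in index_set H.
Proof.
case/existsP=> e /andP[He eST]; rewrite !inE; apply/orP; left.
apply/existsP; exists e; rewrite He; apply/existsP; exists S.
by rewrite two_partitionC.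
Qed.

Lemma unified_entryC S T : unified_entry S T = unified_entry T S.
Proof.
rewrite /unified_entry eq_sym; case: (eqVneq T S) => [-> //|_] /=.
by congr (if _ is Some e then _ else _); apply: eq_pick => e;
   rewrite two_partitionC.
Qed.

Lemma unified_entry_adj S T :
  unified_entry S T != 0%N -> (S == T) || exact_adj S T.
Proof.
rewrite /unified_entry; case: (eqVneq S T) => //= _.
by case: pickP => // e He _; apply/existsP; exists e.
Qed.

Lemma exact_adj_entry S T : exact_adj S T -> (0 < unified_entry S T)%N.
Proof.
case/existsP=> e eST; have /andP[_ /two_partition_neq/negPf nST] := eST.
rewrite /unified_entry nST /=; case: pickP => [f /andP[]|/(_ e)].
  by rewrite in_mset.
by rewrite eST.
Qed.

Lemma exact_adj_walk S (q : seq {set V}) :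
  path exact_adj S q -> exact_walk S (pairmap (fun T T' => (T :|: T', T')) S q).
Proof.
elim: q S => //= T q IHq S /andP[/existsP[e /andP[He eST]] /IHq->].
have /and4P[_ _ _ /eqP->] := eST.
by rewrite He eST.
Qed.

Lemma unzip2_union_pairs S (q : seq {set V}) :
  unzip2 (pairmap (fun T T' => (T :|: T', T')) S q) = q.
Proof. by elim: q S => //= T q IHq S; rewrite IHq. Qed.

(** Erasing the loops of a walk leaves an exact path that is no longer. *)
Lemma adj_path_joined S (q : seq {set V}) :
  S != last S q -> path exact_adj S q ->
  exists2 m, (m <= size q)%N & joined_by_length m S (last S q).
Proof.
move=> nST Sq; case/shortenP: Sq nST => r Sr Ur sub_r nST.
exists (size r); first by apply: uniq_leq_size; first by case/andP: Ur.
pose p := pairmap (fun T T' => (T :|: T', T')) S r.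
have size_p : size p == size r by rewrite size_pairmap.
apply/existsP; exists (Tuple size_p); rewrite /= unzip2_union_pairs eqxx andbT.
rewrite /exact_path unzip2_union_pairs Ur exact_adj_walk // size_pairmap.
(* The path is nonempty because its endpoints differ. *)
by case: r nST {Sr Ur sub_r p size_p} => //=; rewrite eqxx.
Qed.

Variable C : numClosedFieldType.
Notation U := (unified_matrix H C).

Lemma unified_matrix_normal : U \is normalmx.
Proof.
apply: symmetric_normalmx.
  by apply/is_hermitianmxP; rewrite expr0 scale1r; apply/matrixP=> i j;
     rewrite !mxE unified_entryC.
by apply/mxOverP=> i j; rewrite mxE realn.
Qed.

Lemma unified_power_ge0 k i j : 0 <= (U ^+ k) i j.
Proof.
elim: k i j => [|k IHk] i j; first by rewrite expr0 mxE ler0n.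
by rewrite exprS mxE sumr_ge0 // => l _; rewrite mulr_ge0 // mxE ler0n.
Qed.

(** No cancellation can occur, as all walks have nonnegative weight. *)
Lemma exact_walk_power p (i : 'I_(e_index H)) :
  exact_walk (enum_val i) p ->
  exists2 j, enum_val j = last (enum_val i) (unzip2 p)
           & 0 < (U ^+ size p) i j.
Proof.
elim: p i => [|[e T] p IHp] i /=.
  by exists i; rewrite // expr0 mxE eqxx ltr01.
case/and3P=> He eST walk_p.
have adjT : exact_adj (enum_val i) T by apply/existsP; exists e; apply/andP.
have IT := exact_adj_part adjT.
pose l : 'I_(e_index H) := enum_rank_in IT T.
have lT : enum_val l = T by rewrite enum_rankK_in.
rewrite -lT in walk_p *; have [j jT Ulj] := IHp l walk_p; exists j => //.
rewrite exprS mxE (bigD1 l) //= ltr_wpDr //.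
  by rewrite sumr_ge0 // => m _; rewrite mulr_ge0 ?unified_power_ge0 // mxE ler0n.
by rewrite mulr_gt0 // mxE ltr0n exact_adj_entry ?lT.
Qed.

(** The walk may be shorter than [k], as the diagonal entries of the matrix
    allow steps that stay in place. *)
Lemma power_adj_path k (i j : 'I_(e_index H)) :
  (U ^+ k) i j != 0 ->
  exists q : seq {set V}, [/\ (size q <= k)%N, path exact_adj (enum_val i) q
                            & last (enum_val i) q = enum_val j].
Proof.
elim: k i => [|k IHk] i.
  rewrite expr0 mxE pnatr_eq0 eqb0 negbK => /eqP->.
  by exists [::].
rewrite exprS mxE => sum_neq0.
have [l Uilj] : exists l, U i l * (U ^+ k) l j != 0.
  apply/existsP; apply: contraNT sum_neq0 => /existsPn all0.
  by rewrite big1 // => l _; apply/eqP/negPn.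
move: Uilj; rewrite mulf_eq0 negb_or mxE pnatr_eq0 => /andP[Uil /IHk].
case=> q [le_q_k path_q last_q].
have [/eqP il|adj_il] := orP (unified_entry_adj Uil).
  by exists q; rewrite il (leq_trans le_q_k).
by exists (enum_val l :: q); rewrite /= ltnS adj_il.
Qed.

Lemma power_joined k (i j : 'I_(e_index H)) :
  i != j -> (U ^+ k) i j != 0 ->
  exists2 m, (m <= k)%N & joined_by_length m (enum_val i) (enum_val j).
Proof.
move=> nij /power_adj_path[q [le_q_k path_q last_q]].
have [|m le_m_q] := adj_path_joined _ path_q.
  by rewrite last_q (inj_eq enum_val_inj).
by rewrite last_q => Jm; exists m; first exact: leq_trans le_q_k.
Qed.

Lemma least_linked_lt (u v : V) (d : nat) (s : seq C) :
  (forall a, eigenvalue U a -> a \in s) ->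
  linked u v d -> (forall m, linked u v m -> (d <= m)%N) -> (d < size s)%N.
Proof.
move=> eigs /exists_inP[S IS /exists_inP[T IT /and3P[uS vT]]].
case/existsP=> p /andP[/and3P[p_gt0 walk_p uniq_p] /eqP lastT] d_min.
pose i : 'I_(e_index H) := enum_rank_in IS S.
have iS : enum_val i = S by rewrite enum_rankK_in.
have [|j] := @exact_walk_power p i; first by rewrite iS.
rewrite iS lastT size_tuple => jT Udij.
(* A nonempty path with distinct vertices does not return to its origin. *)
have nij : i != j.
  apply: contraTneq uniq_p => ij; rewrite ij jT -lastT in iS.
  rewrite -{1}iS; case: (tval p) p_gt0 => //= x p' _.
  by rewrite mem_last.
apply: (first_nonzero_power_lt unified_matrix_normal eigs _ (lt0r_neq0 Udij)).
move=> k lt_k_d; apply/eqP; apply: contraTT lt_k_d.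
case/(power_joined nij)=> m le_m_k; rewrite iS jT => Jm.
rewrite -leqNgt (leq_trans _ le_m_k) // d_min //.
by apply/exists_inP; exists S => //; apply/exists_inP; exists T => //;
   apply/and3P.
Qed.

End UnifiedGraph.

Theorem theorem5p1 (C : numClosedFieldType) (H : hypergraph) (ell : nat)
    (conn : exactly_connected H)
    (eigs : has_distinct_eigenvalues (unified_matrix H C) ell) :
  (exact_diameter H <= ell - 1)%N.
Proof.
case: eigs => s [_ <- eigs].
apply/bigmax_leqP => u _; apply/bigmax_leqP => v _; rewrite /exact_dist.
case: eqP => // _; case: linkedP => // ex_uv /=.
case: ex_minnP => d uvd d_min; rewrite subn1.
have lt_d_s : (d < size s)%N.
  by apply: least_linked_lt uvd d_min => a; rewrite eigs.
by rewrite -ltnS (ltn_predK lt_d_s).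
Qed.
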